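(* Let $G$ be a finite simple graph with exactly $6$ vertices. Then the twin-width of $G$ satisfies $\mathrm{tww}(G)\leq 2$. In particular, there is no $n$-vertex graph with $n=6$ whose twin-width is at least $n/2=3$.
   Context: A trigraph $G$ consists of a finite vertex set $V(G)$, a set $E(G)$ of black edges and a set $R(G)$ of red edges, where $E(G)$ and $R(G)$ are disjoint sets of unordered pairs of distinct vertices. For a vertex $v$, $N_G(v)$ denotes the set of all vertices adjacent to $v$ by a black or a red edge. A $d$-trigraph is a trigraph $G$ such that the red graph $(V(G),R(G))$ has maximum degree at most $d$. A finite simple graph is regarded as a trigraph with all edges black and no red edges. A contraction in a trigraph $G$ merges two distinct (not necessarily adjacent) vertices $u$ and $v$ into a single new vertex $w$, producing a trigraph $G'$ with vertex set $(V(G)\setminus\{u,v\})\cup\{w\}$ and edges defined as follows. For every $x\in V(G)\setminus\{u,v\}$: if $x$ lies in the symmetric difference $N_G(u)\,\triangle\, N_G(v)$, then $wx$ is a red edge; if $x\in N_G(u)\cap N_G(v)$, then $wx$ is a black edge if both $ux\in E(G)$ and $vx\in E(G)$, and a red edge otherwise; if $x\notin N_G(u)\cup N_G(v)$, then $w$ and $x$ are not adjacent. All edges not incident to $u$ or $v$ remain unchanged (including their colour), and $u$ and $v$, together with the edges incident to them, are removed. For a graph $G$ on $n$ vertices, a sequence of $d$-contractions (a $d$-sequence) is a sequence of $d$-trigraphs $G_n,G_{n-1},\dots,G_1$ where $G_n=G$, $G_1=K_1$ is the one-vertex graph, and each $G_{i-1}$ is obtained from $G_i$ by a single contraction. The twin-width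 $\mathrm{tww}(G)$ is the minimum integer $d\geq 0$ such that $G$ admits a $d$-sequence. *)

(* Defs.v *)
From mathcomp Require Import all_boot.
From mathcomp Require Import boolp.

Set Implicit Arguments.
Unset Strict Implicit.
Unset Printing Implicit Defensive.

Record sgraph := SGraph {
  svertex :> finType;
  sedge : rel svertex;
  sedge_sym : symmetric sedge;
  sedge_irrefl : irreflexive sedge }.

(** Sets of unordered pairs of distinct vertices are encoded as symmetric
    irreflexive relations. *)
Record trigraph := Trigraph {
  vertex :> finType;
  black : rel vertex;
  red : rel vertex;
  black_sym : symmetric black;
  red_sym : symmetric red;
  black_irrefl : irreflexive black;
  red_irrefl : irreflexive red;
  black_red_disjoint : forall x y, ~~ (black x y && red x y) }.

Arguments black {t} x y.
Arguments red {t} x y.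

Section Trigraph.
Variable G : trigraph.

Definition nbhd (v : G) : {set G} := [set x | black v x || red v x].

Definition red_degree (v : G) : nat := #|[set x | red v x]|.

Definition max_red_degree : nat := \max_(v : G) red_degree v.

End Trigraph.

Definition is_dtrigraph (d : nat) (G : trigraph) : Prop :=
  max_red_degree G <= d.

Section TrigraphOfGraph.
Variable G : sgraph.

Fact no_red_sym : symmetric (fun _ _ : G => false). Proof. by []. Qed.
Fact no_red_irrefl : irreflexive (fun _ _ : G => false). Proof. by []. Qed.
Fact no_red_disjoint (x y : G) : ~~ (sedge x y && false).
Proof. by rewrite andbF. Qed.

Definition trigraph_of : trigraph :=
  @Trigraph G _ _ (@sedge_sym G) no_red_sym (@sedge_irrefl G) no_red_irrefl
    no_red_disjoint.

End TrigraphOfGraph.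

Section Contract.
Variables (G : trigraph) (u v : G).

(** [None] is the new vertex [w]; [Some x] is the old vertex [x]. *)
Definition contract_vertex : finType := option {x : G | (x != u) && (x != v)}.

Definition merged_black (x : G) : bool := black u x && black v x.

Definition merged_red (x : G) : bool :=
  (x \in (nbhd u :\: nbhd v) :|: (nbhd v :\: nbhd u))
  || (x \in nbhd u :&: nbhd v) && ~~ (black u x && black v x).

Definition contract_black (a b : contract_vertex) : bool :=
  match a, b with
  | Some x, Some y => black (val x) (val y)
  | None, Some x | Some x, None => merged_black (val x)
  | None, None => false
  end.

Definition contract_red (a b : contract_vertex) : bool :=
  match a, b with
  | Some x, Some y => red (val x) (val y)
  | None, Some x | Some x, None => merged_red (val x)
  | None, None => false
  end.

Fact contract_black_sym : symmetric contract_black.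
Proof. by move=> [x|] [y|] //=; rewrite black_sym. Qed.

Fact contract_red_sym : symmetric contract_red.
Proof. by move=> [x|] [y|] //=; rewrite red_sym. Qed.

Fact contract_black_irrefl : irreflexive contract_black.
Proof. by move=> [x|] //=; rewrite black_irrefl. Qed.

Fact contract_red_irrefl : irreflexive contract_red.
Proof. by move=> [x|] //=; rewrite red_irrefl. Qed.

Fact merged_disjoint x : ~~ (merged_black x && merged_red x).
Proof.
rewrite /merged_black /merged_red !inE.
by case: (black u x); case: (black v x); rewrite ?andbF.
Qed.

Fact contract_disjoint a b : ~~ (contract_black a b && contract_red a b).
Proof.
case: a b => [x|] [y|] //=; rewrite ?merged_disjoint //.
exact: black_red_disjoint.
Qed.

Definition contract : trigraph :=
  Trigraph contract_black_sym contract_red_sym contract_black_irrefl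
    contract_red_irrefl contract_disjoint.

Lemma card_contract : u != v -> #|contract|.+1 = #|G|.
Proof.
move=> uv; rewrite card_option card_sig.
rewrite -(cardC (pred2 u v)) card2 uv; congr (_.+2).
by apply: eq_card => x; rewrite !inE negb_or.
Qed.

End Contract.

Definition trigraph_iso (G H : trigraph) : Prop :=
  exists f : G -> H,
    [/\ bijective f,
        forall x y, black (f x) (f y) = black x y
      & forall x y, red (f x) (f y) = red x y].

(** The name of the new vertex being immaterial, contractions are taken up to
    isomorphism. *)
Definition is_contraction (G H : trigraph) : Prop :=
  exists u v : G, u != v /\ trigraph_iso (contract u v) H.

(** [s i] is the trigraph G_i for 1 <= i <= #|G|, and [s] is unconstrained
    elsewhere. For the empty graph [s 1] is not tied to [G], so the conditions
    are satisfiable with [d = 0]: [tww] of the empty graph is 0 by convention. *)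
Definition is_dsequence (d : nat) (G : sgraph) (s : nat -> trigraph) : Prop :=
  [/\ s #|G| = trigraph_of G,
      #|s 1| = 1,
      forall i, 1 <= i <= #|G| -> is_dtrigraph d (s i)
    & forall i, 1 < i <= #|G| -> is_contraction (s i) (s i.-1)].

Definition has_dsequence (G : sgraph) (d : nat) : Prop :=
  exists s, is_dsequence d G s.

Lemma contraction_sequence n (G : trigraph) : #|G| = n ->
  exists s : nat -> trigraph,
    [/\ s n = G, #|s 1| = 1
      & forall i, 1 < i <= n -> is_contraction (s i) (s i.-1)].
Proof.
have unit_disj (x y : unit) : ~~ (false && false) by [].
pose K1 := @Trigraph unit (fun _ _ => false) (fun _ _ => false)
  (fun _ _ => erefl) (fun _ _ => erefl) (fun _ => erefl) (fun _ => erefl)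
  unit_disj.
elim: n G => [|[|n] IHn] G cardG.
- exists (fun i => if i is 0 then G else K1); split=> //; first exact: card_unit.
  by case=> [|[]].
- by exists (fun=> G); split=> //; case=> [|[]].
have /card_gt1P[u [v [_ _ uv]]] : 1 < #|G| by rewrite cardG.
have [|s [sn s1 sc]] := IHn (contract u v).
  by apply: succn_inj; rewrite card_contract.
exists (fun i => if i == n.+2 then G else s i); split; first by rewrite eqxx.
  by [].
move=> i /andP[i1]; rewrite leq_eqVlt => /orP[/eqP ->|lt_i].
  rewrite eqxx /= ltn_eqF // sn; exists u, v; split=> //.
  by exists id; split=> //; exists id.
rewrite (ltn_eqF lt_i) ltn_eqF ?(leq_ltn_trans (leq_pred i)) //.
by apply: sc; rewrite i1.
Qed.

Lemma has_dsequence_ex (G : sgraph) : exists d, `[< has_dsequence G d >].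
Proof.
have [s [sn s1 sc]] := @contraction_sequence #|G| (trigraph_of G) erefl.
exists (\max_(i < #|G|.+1) max_red_degree (s i)); apply/asboolP.
exists s; split=> // i /andP[_ le_i].
rewrite /is_dtrigraph.
exact: (@leq_bigmax _ (fun j : 'I_#|G|.+1 => max_red_degree (s j))
         (Ordinal (le_i : i < #|G|.+1))).
Qed.

Definition tww (G : sgraph) : nat := ex_minn (has_dsequence_ex G).

(* Main.v *)
Require Import Defs.
From mathcomp Require Import all_boot.
From mathcomp Require Import boolp.

(** Let [a] be any vertex. By pigeonhole three of the five other vertices, say
    [u], [v], [x], are all adjacent or all non-adjacent to [a]. Let [b] be
    another vertex; two of the three, say [u] and [v], look alike from [b].
    Contracting [u] and [v] into [w] creates red edges only from [w], and at most
    to the two vertices other than [a], [b]. Contracting [w] and [x] leaves four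
    vertices, with red edges only at the new vertex, and none of them goes to
    [a]. From three vertices on, every red degree is at most 2. *)

Set Implicit Arguments.
Unset Strict Implicit.
Unset Printing Implicit Defensive.

(** A $d$-sequence read from its first contraction on: every step is literally a [contract], with no
    isomorphisms and no indexing by vertex counts, and any trigraph may start it. *)
Inductive contractible (d : nat) (G : trigraph) : Prop :=
| contractible_one of #|G| = 1 & is_dtrigraph d G
| contractible_step (u v : G) of
    u != v & is_dtrigraph d G & contractible d (contract u v).

Lemma trigraph_iso_refl (G : trigraph) : trigraph_iso G G.
Proof. by exists id; split=> //; exists id. Qed.

Lemma contractible_sequence d (G : trigraph) : contractible d G ->
  exists s : nat -> trigraph,
    [/\ s #|G| = G, #|s 1| = 1,
        forall i, 1 <= i <= #|G| -> is_dtrigraph d (s i)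
      & forall i, 1 < i <= #|G| -> is_contraction (s i) (s i.-1)].
Proof.
elim=> {}G.
  move=> G1 dG; exists (fun=> G); split=> //.
  by rewrite G1 => i /andP[i1 /(leq_trans i1)]; rewrite ltnn.
move=> u v uv dG _ [s [sG s1 sd sc]]; have cardG := card_contract uv.
have s_neq i : i <= #|contract u v| -> (i == #|G|) = false.
  by move=> le_i; rewrite ltn_eqF // -cardG ltnS.
have contract_gt0 : 0 < #|contract u v| by apply/card_gt0P; exists None.
(* The sequence of the contracted trigraph only matters at indices below [#|G|], so its value at
   [#|G|] can be overwritten. *)
exists (fun i => if i == #|G| then G else s i); split.
- by rewrite eqxx.
- by rewrite s_neq.
- move=> i /andP[i0]; rewrite leq_eqVlt -{2}cardG ltnS.
  case/predU1P=> [->|le_i]; first by rewrite eqxx.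
  by rewrite s_neq //; apply: sd; rewrite i0.
- move=> i /andP[i1]; rewrite leq_eqVlt -{2}cardG ltnS.
  case/predU1P=> [->|le_i].
    rewrite eqxx -cardG /= ltn_eqF // sG.
    by exists u, v; split=> //; apply: trigraph_iso_refl.
  rewrite !s_neq ?(leq_trans (leq_pred i)) //.
  by apply: sc; rewrite i1.
Qed.

Lemma tww_le d (G : sgraph) : contractible d (trigraph_of G) -> tww G <= d.
Proof.
move=> /contractible_sequence[s sP]; rewrite /tww.
by case: ex_minnP => m _; apply; apply/asboolP; exists s.
Qed.

Lemma is_dtrigraphP d (G : trigraph) :
  is_dtrigraph d G <-> forall v : G, red_degree v <= d.
Proof. by split=> [/bigmax_leqP dG v|dG]; [apply: dG | apply/bigmax_leqP]. Qed.

(** The red neighbourhood of [v] is disjoint from [s]. Red degrees are bounded below by listing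
    non-neighbours, [v] itself among them. *)
Lemma red_degree_non_neighbours (G : trigraph) (v : G) (s : seq G) :
  uniq s -> {in s, forall x, ~~ red v x} -> red_degree v + size s <= #|G|.
Proof.
move=> /card_uniqP <- nred; rewrite /red_degree -cardUI.
rewrite [X in _ + X]eq_card0 ?addn0 ?max_card // => x; rewrite !inE.
by apply/negP => /andP[vx /nred]; rewrite vx.
Qed.

Lemma small_is_dtrigraph d (G : trigraph) : #|G| <= d.+1 -> is_dtrigraph d G.
Proof.
move=> leG; apply/is_dtrigraphP => v; rewrite -ltnS -addn1.
apply: leq_trans leG; apply: (@red_degree_non_neighbours G v [:: v]) => // x.
by rewrite inE => /eqP ->; rewrite red_irrefl.
Qed.

(** With at most [d.+1] vertices no red degree exceeds [d], and contracting only lowers the count,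
    so any pair may be merged. *)
Lemma small_contractible d (G : trigraph) :
  0 < #|G| <= d.+1 -> contractible d G.
Proof.
move: {2}#|G| (erefl #|G|) => n; elim: n G => [|n IHn] G cardG.
  by rewrite cardG.
case/andP=> G0 leG; have dG := small_is_dtrigraph leG.
have [G1|G1] := leqP #|G| 1.
  by apply: contractible_one => //; apply/eqP; rewrite eqn_leq G1.
have /card_gt1P[u [v [_ _ uv]]] := G1; apply: (contractible_step uv) => //.
have cardC := card_contract uv.
apply: IHn; first by apply: succn_inj; rewrite cardC.
by move: G1; rewrite -cardC ltnS => ->; rewrite ltnW // cardC.
Qed.

(** A red edge at [u] or [v] is not black, so the merged edge is red; without one, adjacency is
    black adjacency and only disagreement yields red. *)
Lemma merged_redE (G : trigraph) (u v x : G) :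
  merged_red u v x = [|| red u x, red v x | black u x != black v x].
Proof.
rewrite /merged_red !inE.
have := black_red_disjoint u x; have := black_red_disjoint v x.
by case: (black u x); case: (black v x); case: (red u x); case: (red v x).
Qed.

Definition red_star (G : trigraph) (u : G) :=
  forall x y : G, red x y -> (x == u) || (y == u).

(** Red edges between old vertices are inherited, hence were incident to [u], which is gone. *)
Lemma contract_red_star (G : trigraph) (u v : G) :
  red_star u -> @red_star (contract u v) None.
Proof.
move=> star [x|] [y|] //= /star.
by case/andP: (valP x) => /negbTE -> _; case/andP: (valP y) => /negbTE ->.
Qed.

(** A vertex other than the centre has at most the centre as red neighbour. *)
Lemma red_star_is_dtrigraph d (G : trigraph) (u : G) :
  0 < d -> red_star u -> red_degree u <= d -> is_dtrigraph d G.
Proof.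
move=> d0 star du; apply/is_dtrigraphP => v; have [->//|vu] := eqVneq v u.
apply: leq_trans d0; rewrite -(cards1 u); apply/subset_leq_card/subsetP => x.
by rewrite !inE => /star; rewrite (negbTE vu).
Qed.

Lemma exists_alike_triple (T : finType) (e : rel T) : 5 < #|T| ->
  exists a b u v x : T,
    [/\ uniq [:: a; b; u; v; x], e u a = e v a, e v a = e x a & e u b = e v b].
Proof.
move=> T5; have /card_gt0P[a _] : 0 < #|T| by apply: leq_trans T5.
have [c] : exists c, 2 < #|[set x | (x != a) && (e x a == c)]|.
  have : 4 < #|[set~ a]| by rewrite cardsC1 -ltnS prednK // (leq_trans _ T5).
  rewrite -(cardsID [set x | e x a == true]) => sum.
  have split_neq c : [set x | (x != a) && (e x a == c)]
      = [set~ a] :&: [set x | e x a == c] by apply/setP => x; rewrite !inE.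
  have [lt2|le2] := ltnP 2 #|[set~ a] :&: [set x | e x a == true]|.
    by exists true; rewrite split_neq.
  (* At most two of at least five vertices lie in the first class, so the other has at least
     three. *)
  exists false; rewrite split_neq.
  move: (leq_trans sum (leq_add le2 (leqnn _))); rewrite add2n !ltnS.
  congr (_ < _); apply: eq_card => x; rewrite !inE.
  by case: (e x a); rewrite ?andbF ?andbT.
case/card_gt2P=> u [v [x [[]]]]; rewrite !inE.
move=> /andP[ua /eqP eu] /andP[va /eqP ev] /andP[xa /eqP ex] [uv vx xu].
have [b bP] : exists b, b \notin [:: a; u; v; x].
  apply/existsP; rewrite -negb_forall; apply: contraL T5 => /forallP sub.
  rewrite -leqNgt; apply: (@leq_trans 4) => //.
  apply: leq_trans (card_size [:: a; u; v; x]).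
  by apply/subset_leq_card/subsetP => y _; apply: sub.
move: bP; rewrite !inE !negb_or => /and4P[ba bu bv bx].
(* The distinctness hypotheses on [y], [z], [t] are cyclic, to fit each rotation of the triple [u],
   [v], [x]. *)
have uniqP y z t : y != a -> z != a -> t != a -> b != y -> b != z -> b != t ->
    y != z -> z != t -> t != y -> uniq [:: a; b; y; z; t].
  move=> ya za ta by_ bz bt yz zt ty.
  rewrite /= !inE !negb_or ![a == _]eq_sym ba ya za ta by_ bz bt yz zt.
  by rewrite [y == t]eq_sym ty.
have [uvb|uvb] := eqVneq (e u b) (e v b).
  by exists a, b, u, v, x; split; rewrite ?eu ?ev ?ex // uniqP.
have [vxb|vxb] := eqVneq (e v b) (e x b).
  by exists a, b, v, x, u; split; rewrite ?eu ?ev ?ex // uniqP.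
exists a, b, x, u, v; split; rewrite ?eu ?ev ?ex // ?uniqP //.
by move: uvb vxb; case: (e u b); case: (e v b); case: (e x b).
Qed.

Lemma six_vertices_contractible (G : sgraph) :
  #|G| = 6 -> contractible 2 (trigraph_of G).
Proof.
move=> G6.
have [a [b [u [v [x [uniq_s uva vxa uvb]]]]]] :
  exists a b u v x : trigraph_of G,
    [/\ uniq [:: a; b; u; v; x], black u a = black v a,
        black v a = black x a & black u b = black v b].
  by apply: exists_alike_triple; rewrite [#|_|]G6.
move: uniq_s; rewrite /= !inE !negb_or andbT.
case/and4P=> /and4P[ab au av ax] /and3P[bu bv bx] /andP[uv ux] vx.
have noredG y z : @red (trigraph_of G) y z = false by [].
have aP : (a != u) && (a != v) by rewrite au.
have bP : (b != u) && (b != v) by rewrite bu.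
have xP : (x != u) && (x != v) by rewrite !(eq_sym x) ux.
pose a1 : contract u v := Some (exist _ a aP).
pose b1 : contract u v := Some (exist _ b bP).
pose x1 : contract u v := Some (exist _ x xP).
pose w1 : contract u v := None.
have wx : w1 != x1 by [].
have a1P : (a1 != w1) && (a1 != x1) by rewrite /= (inj_eq Some_inj) -val_eqE.
pose a2 : contract w1 x1 := Some (exist _ a1 a1P).
have star1 : red_star w1 by apply: contract_red_star.
have card1 : #|contract u v| = 5.
  by apply: succn_inj; rewrite card_contract.
have card2 : #|contract w1 x1| = 4.
  by apply: succn_inj; rewrite card_contract.
apply: (contractible_step uv).
  by apply/is_dtrigraphP => y; rewrite /red_degree eq_card0 // => z; rewrite inE.
apply: (contractible_step wx).
  apply: (red_star_is_dtrigraph _ star1) => //.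
  (* Five vertices, of which [w1], [a1], [b1] are not red neighbours of [w1], leave at most two. *)
  rewrite -(leq_add2r 3) -[2 + 3]card1.
  apply: (@red_degree_non_neighbours _ w1 [:: w1; a1; b1]).
    by rewrite /= !inE andbT (inj_eq Some_inj) -val_eqE.
  move=> y; rewrite !inE => /or3P[] /eqP -> //=; rewrite merged_redE.
    by rewrite !noredG uva eqxx.
  by rewrite !noredG uvb eqxx.
have /card_gt1P[y [z [_ _ yz]]] : 1 < #|contract w1 x1| by rewrite card2.
apply: (contractible_step yz).
  apply: (@red_star_is_dtrigraph _ (contract w1 x1) None) => //.
    exact: contract_red_star.
  (* Four vertices, less the merged one and [a2], leave two. *)
  rewrite -(leq_add2r 2) -[2 + 2]card2.
  apply: (@red_degree_non_neighbours (contract w1 x1) None [:: None; a2]) => //.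
  move=> t; rewrite !inE => /orP[] /eqP -> //=; rewrite merged_redE /=.
  (* The edge from [w1] to [a1] is not red, and it is black exactly when the edge from [x] to [a]
     is. *)
  by rewrite merged_redE !noredG /merged_black uva vxa eqxx andbb /= eqxx.
apply: small_contractible.
by have := card_contract yz; rewrite card2; case=> ->.
Qed.

Theorem theorem1p2 :
  (forall G : sgraph, #|G| = 6 -> tww G <= 2) /\
  ~ (exists G : sgraph, #|G| = 6 /\ 6 %/ 2 <= tww G).
Proof.
have le2 (G : sgraph) : #|G| = 6 -> tww G <= 2.
  by move=> G6; apply/tww_le/six_vertices_contractible.
by split=> // -[G [/le2 leG]]; rewrite leqNgt ltnS leG.
Qed.
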